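(* Suppose that the factorization $T=L_1\cdots L_pU_q\cdots U_1$ is positive. Then every cyclic product $T_{(a)}$, $a\in\{1,\dots,M\}$, admits a normalized positive bidiagonal factorization with $p$ lower factors followed by $q$ upper factors. Such a factorization is obtained from the ordered list $(F_a,\dots,F_M,F_1,\dots,F_{a-1})$ by finitely many adjacent refactorizations, carried out until no upper factor precedes a lower factor, and the resulting lower--upper factors are independent of the sequence of adjacent refactorizations. If the coefficients of the original factors are bounded, the coefficients in every one of these cyclic factorizations are bounded.
   Context: Let $p,q\ge1$ and $M=p+q$. All matrices are semi-infinite, indexed by $\mathbb N_0$. A lower bidiagonal matrix $L$ is normalized if $L_{n,n}=1$; its coefficients are the entries $L_{n+1,n}$. An upper bidiagonal matrix $U$ is normalized if $U_{n,n+1}=1$; its coefficients are the entries $U_{n,n}$. A normalized bidiagonal matrix is positive if all its coefficients are strictly positive. $L_1,\dots,L_p$ are normalized lower bidiagonal, $U_1,\dots,U_q$ are normalized upper bidiagonal, and $T=L_1\cdots L_pU_q\cdots U_1$; the factorization is positive if all these factors are positive. Enumerate the factors in order of appearance: $F_a=L_a$ for $1\le a\le p$ and $F_{p+b}=U_{q-b+1}$ for $1\le b\le q$, so $T=F_1\cdots F_M$. The cyclic products are $T_{(a)}=F_aF_{a+1}\cdots F_MF_1\cdots F_{a-1}$. An adjacent refactorization of an ordered list of normalized positive bidiagonal factors replaces two neighbouring factors $U,L$ (in this order, $U$ upper and $L$ lower) by the unique normalized positive pair $\widetilde L,\widetilde U$ (in this order, $\widetilde L$ lower and $\widetilde U$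 upper) with $UL=\widetilde L\widetilde U$; such a pair always exists and is unique. *)

(* Defs.v *)
From Stdlib Require Export Relation_Operators.
From HB Require Import structures.
From mathcomp Require Export all_boot all_order all_algebra.
From mathcomp Require Export boolp classical_sets fsbigop reals topology normedtype.

Set Implicit Arguments.
Unset Strict Implicit.
Unset Printing Implicit Defensive.

Import Order.TTheory GRing.Theory Num.Theory.
Import numFieldNormedType.Exports.
Local Open Scope classical_set_scope.
Local Open Scope ring_scope.

Definition semimx (R : realType) : Type := nat -> nat -> R.

Section Bidiagonal.
Variable R : realType.
Implicit Types (A B : semimx R) (s : seq (semimx R)).

Definition semimx1 : semimx R := fun i j => (i == j)%:R.

(* The sum over k is the finitely supported sum of fsbigop, which is the
   actual matrix product as soon as the rows of A (or the columns of B) have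
   finite support; all products below are products of bidiagonal matrices. *)
Definition mulsemimx A B : semimx R :=
  fun i j => \sum_(k \in [set: nat]) (A i k * B k j).

Definition prodsemimx s : semimx R := foldr mulsemimx semimx1 s.

Definition lower_bidiagonal A :=
  forall i j : nat, j <> i -> i <> j.+1 -> A i j = 0.

Definition upper_bidiagonal A :=
  forall i j : nat, j <> i -> j <> i.+1 -> A i j = 0.

Definition normalized_lower A :=
  lower_bidiagonal A /\ forall n, A n n = 1.

Definition normalized_upper A :=
  upper_bidiagonal A /\ forall n, A n n.+1 = 1.

Definition lower_coef A : nat -> R := fun n => A n.+1 n.

Definition upper_coef A : nat -> R := fun n => A n n.

Definition positive_lower A :=
  normalized_lower A /\ forall n, 0 < lower_coef A n.

Definition positive_upper A :=
  normalized_upper A /\ forall n, 0 < upper_coef A n.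

(* The ordered list (L_1, ..., L_p, U_q, ..., U_1): the tuples list
   L_1, ..., L_p and U_1, ..., U_q by increasing index. *)
Definition factors p q (L : p.-tuple (semimx R)) (U : q.-tuple (semimx R)) :
    seq (semimx R) :=
  L ++ rev U.

Definition positive_factors p q (L : p.-tuple (semimx R))
    (U : q.-tuple (semimx R)) :=
  (forall i, positive_lower (tnth L i)) /\
  (forall i, positive_upper (tnth U i)).

Definition bounded_factors p q (L : p.-tuple (semimx R))
    (U : q.-tuple (semimx R)) :=
  (forall i, bounded_fun (lower_coef (tnth L i))) /\
  (forall i, bounded_fun (upper_coef (tnth U i))).

(* (F_a, ..., F_M, F_1, ..., F_(a-1)) when s = (F_1, ..., F_M) and
   1 <= a <= M. *)
Definition cyclic_list s (a : nat) : seq (semimx R) := rot a.-1 s.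

Definition cyclic_product s (a : nat) : semimx R :=
  prodsemimx (cyclic_list s a).

(* A relation rather than a function: it allows any normalized positive pair
   L', U' with U L = L' U'. Such a pair exists and is unique, so a step is
   determined by the position of the pair U, L. *)
Definition adjacent_refactorization s s' :=
  exists (s1 s2 : seq (semimx R)) (U L L' U' : semimx R),
    [/\ s = s1 ++ [:: U, L & s2],
        s' = s1 ++ [:: L', U' & s2],
        positive_upper U /\ positive_lower L,
        positive_lower L' /\ positive_upper U' &
        mulsemimx U L = mulsemimx L' U'].

Definition adjacent_refactorizations s s' :=
  clos_refl_trans _ adjacent_refactorization s s'.

(* No matrix is both normalized lower and normalized upper bidiagonal (compare
   the superdiagonals), so the kind of a factor need not be recorded. *)
Definition lower_upper_ordered s :=
  forall (s1 s2 s3 : seq (semimx R)) A B,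
    s = s1 ++ A :: s2 ++ B :: s3 ->
    ~ (normalized_upper A /\ normalized_lower B).

End Bidiagonal.

(* Main.v *)
From Stdlib Require Import Relation_Operators Operators_Properties.
Require Import Defs.
From mathcomp Require Import all_boot all_order all_algebra.
From mathcomp Require Import reals.
From mathcomp Require Import boolp classical_sets fsbigop.
From mathcomp Require Import zify ring lra.

(** An adjacent refactorization moves one lower factor to the left across one
    upper factor. Comparing entries, with $u$, $l$ the coefficients of $U$, $L$
    and $l'$, $u'$ those of $L'$, $U'$, the identity $U L = L' U'$ says
      $u'_n + l'_{n-1} = u_n + l_n$ and $l'_n u'_n = u_{n+1} l_n$
    with $l'_{-1} = 0$ ([exchangeP]); these are the rhombus rules of the
    quotient-difference algorithm. They determine $u'_0, l'_0, u'_1, ...$ in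
    this order, and an induction gives $l_n < u'_n$, hence
    $0 < l'_n < u_{n+1}$ ([exchange_gt]). So the new pair exists, is unique and
    positive, and $l' <= sup u$, $u' <= sup u + sup l$: refactorization
    preserves boundedness.

    What remains is a rewriting argument on lists of factors. Every step
    removes exactly one inversion (an upper factor before a lower one), so
    there is no infinite sequence of steps. Two steps that start from the same
    list either act on the same pair, and then agree by uniqueness, or act on
    disjoint pairs, and then commute: an overlap would make the lower factor of
    one pair the upper factor of the other ([step_diamond]). The diamond
    property makes the normal form unique. A positive list admits no step
    exactly when all its lower factors come first, and the product, the
    positivity, the numbers of factors of each kind and the boundedness are
    invariant under steps, so the normal form of a cyclic list is the required
    factorization. *)

Section BidiagonalRefactorization.
Import Order.TTheory GRing.Theory Num.Theory.
Import numFieldNormedType.Exports.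
Local Open Scope classical_set_scope.
Local Open Scope ring_scope.
Set Implicit Arguments.
Unset Strict Implicit.
Unset Printing Implicit Defensive.

(** * Normal forms of a terminating relation with the diamond property *)

Section Rewriting.
Variables (T : Type) (r : T -> T -> Prop).
Local Notation "x ->* y" := (clos_refl_trans T r x y) (at level 70).

Definition normal_form x := forall y, ~ r x y.

Lemma clos_refl_trans_preserves (Q : T -> Prop) x y :
  (forall x y, r x y -> Q x -> Q y) -> x ->* y -> Q x -> Q y.
Proof. by move=> rQ; elim=> {x y} [x y /rQ|//|x y z _ IH1 _ IH2 /IH1/IH2]. Qed.

Section Termination.
Variable m : T -> nat.
Hypothesis decr : forall x y, r x y -> (m y < m x)%N.

Lemma normal_form_exists x : exists2 y, x ->* y & normal_form y.
Proof.
have [n] := ubnP (m x); elim: n x => // n IHn x lt_xn.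
have [[y rxy]|nx] := pselect (exists y, r x y); last first.
  by exists x; [exact: rt_refl | move=> y rxy; apply: nx; exists y].
have [z ryz nz] := IHn y (leq_trans (decr rxy) lt_xn).
by exists z => //; apply: rt_trans ryz; apply: rt_step.
Qed.

Lemma no_infinite_chain x :
  ~ exists f : nat -> T, f 0%N = x /\ forall n, r (f n) (f n.+1).
Proof.
move=> [f [_ rf]].
have le n : (m (f n) + n <= m (f 0%N))%N.
  elim: n => [|n IHn]; first by rewrite addn0.
  by have := decr (rf n); lia.
by have := le (m (f 0%N)).+1; lia.
Qed.

End Termination.

Section Diamond.
Hypothesis diamond : forall x y z,
  r x y -> r x z -> y = z \/ exists2 w, r y w & r z w.

(** No choice of a first step can lose a normal form: the diamond carries the
    detour along the whole path from [x] to [z], and it collapses at the end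
    because [z] admits no step. *)
Lemma step_to_normal_form x y z : r x y -> x ->* z -> normal_form z -> y ->* z.
Proof.
move=> rxy /(@clos_rt_rt1n T r x z) rxz nz.
elim: rxz nz y rxy => {x z} [x nx y /nx//|x w z rxw rwz IH nz y rxy].
have [->|[v ryv rwv]] := diamond rxy rxw; first exact: clos_rt1n_rt.
by apply: rt_trans (IH nz v rwv); apply: rt_step.
Qed.

Lemma normal_form_unique x y z :
  x ->* y -> normal_form y -> x ->* z -> normal_form z -> y = z.
Proof.
move=> /(@clos_rt_rt1n T r x y) rxy ny rxz nz.
elim: rxy ny rxz => {x y} [x nx|x w y rxw _ IH ny rxz].
  by move=> /(@clos_rt_rt1n T r x z); case=> [//|w z' /nx].
by apply: IH => //; apply: step_to_normal_form rxz nz.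
Qed.

End Diamond.
End Rewriting.

(** * Bidiagonal matrices and their products *)

Context {R : realType}.
Implicit Types (A B L U P : semimx R) (s t : seq (semimx R)).
Implicit Types (u l : nat -> R).

Definition lower_mx l : semimx R := fun i j =>
  if i is k.+1 then l k * (k == j)%:R + (k.+1 == j)%:R else (0 == j)%:R.

Definition upper_mx u : semimx R := fun i j =>
  u i * (i == j)%:R + (i.+1 == j)%:R.

Lemma lower_mx_normalized l : normalized_lower (lower_mx l).
Proof.
split=> [[|i] j ji ij|[|n]] /=.
- by case: eqP ji => // <-.
- case: eqP ij => [-> //|_ _]; case: eqP ji => [<- //|_ _].
  by rewrite mulr0 addr0.
- by [].
- by rewrite eqn_leq ltnn andbF mulr0 add0r eqxx.
Qed.

Lemma upper_mx_normalized u : normalized_upper (upper_mx u).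
Proof.
split=> [i j ji ij|n]; rewrite /upper_mx.
  case: eqP ji => [<- //|_ _]; case: eqP ij => [<- //|_ _].
  by rewrite mulr0 addr0.
by rewrite eqxx eqn_leq ltnn andbF mulr0 add0r.
Qed.

Lemma lower_coef_mx l : lower_coef (lower_mx l) = l.
Proof.
by apply: funext=> n; rewrite /lower_coef /= eqxx eqn_leq ltnn mulr1 addr0.
Qed.

Lemma upper_coef_mx u : upper_coef (upper_mx u) = u.
Proof.
apply: funext=> n.
by rewrite /upper_coef /upper_mx eqxx eqn_leq ltnn mulr1 addr0.
Qed.

Lemma normalized_lowerE L :
  normalized_lower L -> L = lower_mx (lower_coef L).
Proof.
move=> [bL dL]; apply: funext=> i; apply: funext=> j.
have [bL' dL'] := lower_mx_normalized (lower_coef L).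
have [->|/eqP ji] := eqVneq j i; first by rewrite dL dL'.
have [->|/eqP ij] := eqVneq i j.+1; last by rewrite bL // bL'.
by rewrite -/(lower_coef (lower_mx _) j) lower_coef_mx.
Qed.

Lemma normalized_upperE U :
  normalized_upper U -> U = upper_mx (upper_coef U).
Proof.
move=> [bU dU]; apply: funext=> i; apply: funext=> j.
have [bU' dU'] := upper_mx_normalized (upper_coef U).
have [->|/eqP ji] := eqVneq j i.+1; first by rewrite dU dU'.
have [->|/eqP ij] := eqVneq j i; last by rewrite bU // bU'.
by rewrite -/(upper_coef (upper_mx _) i) upper_coef_mx.
Qed.

(** Rows with finite support turn the finitely supported sum into an ordinary
    one; bidiagonal rows then give the two-term recurrences below, valid for an
    arbitrary right factor. *)
Lemma mulsemimx_row A B i j (r : seq nat) : uniq r ->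
    (forall k, k \notin r -> A i k = 0) ->
  mulsemimx A B i j = \sum_(k <- r) A i k * B k j.
Proof.
move=> ur Ar; rewrite /mulsemimx (@fsbigE _ _ _ _ _ r) //.
  by apply: eq_bigl => k; rewrite in_setT.
by move=> k _ /Ar ->; rewrite mul0r.
Qed.

Lemma mul_upper_mx u B i j :
  mulsemimx (upper_mx u) B i j = u i * B i j + B i.+1 j.
Proof.
have [bU dU] := upper_mx_normalized u.
rewrite (@mulsemimx_row _ _ _ _ [:: i; i.+1]).
- rewrite !big_cons big_nil addr0 dU mul1r.
  by rewrite -/(upper_coef (upper_mx u) i) upper_coef_mx.
- by rewrite /= inE eqn_leq ltnn andbF.
- by move=> k; rewrite !inE negb_or => /andP[/eqP ki /eqP kS]; apply: bU.
Qed.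

Lemma mul_lower_mx l B i j :
  mulsemimx (lower_mx l) B i j =
    (if i is k.+1 then l k * B k j else 0) + B i j.
Proof.
have [bL dL] := lower_mx_normalized l.
case: i => [|i].
  rewrite (@mulsemimx_row _ _ _ _ [:: 0%N]) // ?big_seq1 ?mul1r ?add0r //.
  by move=> k; rewrite inE => /eqP k0; apply: bL.
rewrite (@mulsemimx_row _ _ _ _ [:: i; i.+1]).
- rewrite !big_cons big_nil addr0 dL mul1r.
  by rewrite -/(lower_coef (lower_mx l) i) lower_coef_mx.
- by rewrite /= inE eqn_leq ltnn andbF.
- move=> k; rewrite !inE negb_or => /andP[/eqP ki /eqP kS]; apply: bL => //.
  by case=> ik; apply: ki.
Qed.

(** * The quotient-difference relations *)

(** The rhombus rules, that is, the entries of $U L = L' U'$ on the diagonal and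
    on the subdiagonal. *)
Definition exchange u l l' u' :=
  (forall n, u' n + (if n is m.+1 then l' m else 0) = u n + l n) /\
  (forall n, l' n * u' n = u n.+1 * l n).

(** This is $(U L) P = (L' U') P$ with both sides reassociated. It is read off
    the row recurrences, which avoids associativity of infinite matrix products
    for an arbitrary $P$. *)
Lemma exchange_mulA u l l' u' P : exchange u l l' u' ->
  mulsemimx (upper_mx u) (mulsemimx (lower_mx l) P) =
  mulsemimx (lower_mx l') (mulsemimx (upper_mx u') P).
Proof.
move=> [eD eM]; apply: funext=> i; apply: funext=> j.
rewrite mul_upper_mx !mul_lower_mx mul_upper_mx.
have {}eD : u' i = u i + l i - (if i is m.+1 then l' m else 0).
  by rewrite -eD addrK.
case: i eD => [|i] ->; first by ring.
rewrite mul_upper_mx [l' i * (_ + _)]mulrDr [l' i * (_ * _)]mulrA eM; ring.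
Qed.

Lemma mul_lower_mx1 l : mulsemimx (lower_mx l) (@semimx1 R) = lower_mx l.
Proof.
by apply: funext=> -[|i]; apply: funext=> j; rewrite mul_lower_mx ?add0r.
Qed.

Lemma mul_upper_mx1 u : mulsemimx (upper_mx u) (@semimx1 R) = upper_mx u.
Proof. by apply: funext=> i; apply: funext=> j; rewrite mul_upper_mx. Qed.

Lemma exchangeP u l l' u' : exchange u l l' u' <->
  mulsemimx (upper_mx u) (lower_mx l) = mulsemimx (lower_mx l') (upper_mx u').
Proof.
split=> [/(exchange_mulA (@semimx1 R))|e].
  by rewrite mul_lower_mx1 mul_upper_mx1.
have {}e i j : mulsemimx (upper_mx u) (lower_mx l) i j =
  mulsemimx (lower_mx l') (upper_mx u') i j by rewrite e.
split=> n.
  have := e n n; rewrite mul_upper_mx mul_lower_mx.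
  have [_ ->] := lower_mx_normalized l; rewrite mulr1.
  rewrite -/(lower_coef (lower_mx l) n) lower_coef_mx => ->.
  rewrite -/(upper_coef (upper_mx u') n) upper_coef_mx addrC.
  case: n => // n; congr (_ + _).
  by have [_ ->] := upper_mx_normalized u'; rewrite mulr1.
have := e n.+1 n; rewrite mul_upper_mx mul_lower_mx.
rewrite -/(lower_coef (lower_mx l) n) lower_coef_mx.
rewrite -/(upper_coef (upper_mx u') n) upper_coef_mx.
rewrite (_ : lower_mx l n.+2 n = 0); last first.
  by apply: (lower_mx_normalized l).1; lia.
rewrite (_ : upper_mx u' n.+1 n = 0) ?addr0; last first.
  by apply: (upper_mx_normalized u').1; lia.
by move=> <-.
Qed.

(** The recursion $u'_{n+1} = u_{n+1} + l_{n+1} - l'_n$ contains a subtraction,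
    so positivity alone is not inductive; $l_n < u'_n$ is. It gives
    $l'_n = u_{n+1} l_n / u'_n < u_{n+1}$, whence $u'_{n+1} > l_{n+1}$. *)
Lemma exchange_gt u l l' u' : exchange u l l' u' ->
  (forall n, 0 < u n) -> (forall n, 0 < l n) -> 
  forall n, l n < u' n /\ 0 < l' n < u n.+1.
Proof.
move=> [eD eM] u0 l0.
have small n : l n < u' n -> 0 < l' n < u n.+1.
  move=> lt_lu; have u'0 : 0 < u' n := lt_trans (l0 n) lt_lu.
  have -> : l' n = u n.+1 * l n / u' n by rewrite -eM mulfK // gt_eqF.
  by rewrite divr_gt0 ?mulr_gt0 //= ltr_pdivrMr // ltr_pM2l.
suff lu n : l n < u' n by move=> n; split=> //; apply: small.
elim: n => [|n /small/andP[_ lt_l'u]].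
  by have := eD 0%N; rewrite addr0 => ->; have := u0 0%N; lra.
by have := eD n.+1; lra.
Qed.

(** The rhombus rules solved for $u'$, with $l'$ eliminated. *)
Fixpoint exchanged_upper u l n : R :=
  if n is m.+1
  then u m.+1 + l m.+1 - u m.+1 * l m / exchanged_upper u l m
  else u 0%N + l 0%N.

Definition exchanged_lower u l n : R := u n.+1 * l n / exchanged_upper u l n.

Lemma exchange_exists u l : (forall n, 0 < u n) -> (forall n, 0 < l n) ->
  exchange u l (exchanged_lower u l) (exchanged_upper u l).
Proof.
move=> u0 l0.
have lu n : l n < exchanged_upper u l n.
  elim: n => [|n IHn] /=; first by have := u0 0%N; lra.
  have v0 := lt_trans (l0 n) IHn; rewrite -subr_gt0.
  have -> : u n.+1 + l n.+1 - u n.+1 * l n / exchanged_upper u l n - l n.+1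
    = u n.+1 - u n.+1 * l n / exchanged_upper u l n by ring.
  by rewrite subr_gt0 ltr_pdivrMr // ltr_pM2l.
split=> [[|n]|n]; rewrite /exchanged_lower ?addr0 //= ?subrK //.
by rewrite mulfVK // gt_eqF // (lt_trans (l0 n)).
Qed.

Lemma exchange_unique u l l1 u1 l2 u2 :
    (forall n, 0 < u n) -> (forall n, 0 < l n) ->
  exchange u l l1 u1 -> exchange u l l2 u2 -> l1 = l2 /\ u1 = u2.
Proof.
move=> u0 l0 e1 e2.
have eq_l n : u1 n = u2 n -> l1 n = l2 n.
  have [lt_l _] := exchange_gt e1 u0 l0 n.
  have u1n0 : u1 n != 0 by rewrite gt_eqF // (lt_trans (l0 n)).
  by move=> equ; apply: (mulIf u1n0); rewrite e1.2 equ e2.2.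
have eq_u n : u1 n = u2 n.
  elim: n => [|n /eq_l eq_ln].
    by have := e1.1 0%N; rewrite -e2.1 !addr0.
  by have := e1.1 n.+1; rewrite -e2.1 eq_ln => /addIr.
by split; apply: funext=> n; auto.
Qed.

Lemma bounded_funE (f : nat -> R) :
  bounded_fun f <-> exists M, forall n, `|f n| <= M.
Proof.
split=> [[M [_ fM]]|[M fM]].
  by exists (M + 1) => n; apply: fM => //; rewrite ltrDl.
exists M; split; first exact: num_real.
by move=> x Mx n _; apply: le_trans (fM n) (ltW Mx).
Qed.

(** Positivity makes the bounds $l'_n < u_{n+1}$ and
    $u'_n <= u_n + l_n$ two-sided. *)
Lemma exchange_bounded u l l' u' : exchange u l l' u' ->
    (forall n, 0 < u n) -> (forall n, 0 < l n) ->
    bounded_fun u -> bounded_fun l -> bounded_fun l' /\ bounded_fun u'.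
Proof.
move=> e u0 l0 /bounded_funE[Mu uM] /bounded_funE[Ml lM].
have gt := exchange_gt e u0 l0.
have leu n : u n <= Mu := le_trans (ler_norm _) (uM n).
have lel n : l n <= Ml := le_trans (ler_norm _) (lM n).
split; apply/bounded_funE; [exists Mu => n|exists (Mu + Ml) => n].
  have [_ /andP[l'0 l'u]] := gt n.
  by rewrite gtr0_norm // (le_trans (ltW l'u)).
have [ltl _] := gt n.
rewrite gtr0_norm ?(lt_trans (l0 n)) // (le_trans _ (lerD (leu n) (lel n))) //.
rewrite -e.1 lerDl; case: n {ltl} => // n.
by have [_ /andP[/ltW]] := gt n.
Qed.

(** * Refactorization of one pair *)

(** The entry (0, 1) is 0 in a lower bidiagonal matrix and 1 in a normalized
    upper one. *)
Lemma lower_upper_absurd A : normalized_lower A -> normalized_upper A -> False.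
Proof.
move=> [bA _] [_ /(_ 0%N)]; rewrite bA // => /esym/eqP.
by rewrite oner_eq0.
Qed.

Definition refactors U L L' U' :=
  [/\ positive_upper U /\ positive_lower L,
      positive_lower L' /\ positive_upper U' &
      mulsemimx U L = mulsemimx L' U'].

Lemma refactors_exchange U L L' U' : refactors U L L' U' ->
  exchange (upper_coef U) (lower_coef L) (lower_coef L') (upper_coef U').
Proof.
move=> [[[nU _] [nL _]] [[nL' _] [nU' _]] e]; apply/exchangeP.
by rewrite -!normalized_upperE -?normalized_lowerE.
Qed.

Lemma refactors_exists U L : positive_upper U -> positive_lower L ->
  exists L' U', refactors U L L' U'.
Proof.
move=> posU posL; have e := exchange_exists posU.2 posL.2.
have gt := exchange_gt e posU.2 posL.2.
exists (lower_mx (exchanged_lower (upper_coef U) (lower_coef L))).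
exists (upper_mx (exchanged_upper (upper_coef U) (lower_coef L))).
split=> //.
  split; split; rewrite ?lower_coef_mx ?upper_coef_mx.
  - exact: lower_mx_normalized.
  - by move=> n; have [_ /andP[]] := gt n.
  - exact: upper_mx_normalized.
  - by move=> n; have [ln _] := gt n; apply: lt_trans (posL.2 n) ln.
rewrite (normalized_upperE posU.1) (normalized_lowerE posL.1).
by rewrite ?lower_coef_mx ?upper_coef_mx; apply/exchangeP.
Qed.

Lemma refactors_unique U L L1 U1 L2 U2 :
  refactors U L L1 U1 -> refactors U L L2 U2 -> L1 = L2 /\ U1 = U2.
Proof.
move=> r1 r2; have [[posU posL] [[nL1 _] [nU1 _]] _] := r1.
have [_ [[nL2 _] [nU2 _]] _] := r2.
have [eL eU] := exchange_unique posU.2 posL.2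
  (refactors_exchange r1) (refactors_exchange r2).
rewrite (normalized_lowerE nL1) (normalized_lowerE nL2) eL.
by rewrite (normalized_upperE nU1) (normalized_upperE nU2) eU.
Qed.

Lemma refactors_mul U L L' U' P : refactors U L L' U' ->
  mulsemimx U (mulsemimx L P) = mulsemimx L' (mulsemimx U' P).
Proof.
move=> r; have [[[nU _] [nL _]] [[nL' _] [nU' _]] _] := r.
have := exchange_mulA P (refactors_exchange r).
by rewrite -!normalized_upperE -?normalized_lowerE.
Qed.

(** Both diagonals are bounded whatever the kind of [A], so that boundedness is
    preserved along lists without recording kinds: for a normalized bidiagonal
    matrix the diagonal that does not hold its coefficients is constant. *)
Definition bounded_coefs A :=
  bounded_fun (lower_coef A) /\ bounded_fun (upper_coef A).

Lemma bounded_coefs_lower L : normalized_lower L ->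
  bounded_coefs L <-> bounded_fun (lower_coef L).
Proof.
move=> [_ dL]; split=> [[]//|bL]; split=> //.
by apply/bounded_funE; exists 1 => n; rewrite /upper_coef dL normr1.
Qed.

Lemma bounded_coefs_upper U : normalized_upper U ->
  bounded_coefs U <-> bounded_fun (upper_coef U).
Proof.
move=> [bU _]; split=> [[]//|bdU]; split=> //.
apply/bounded_funE; exists 0 => n.
by rewrite /lower_coef bU ?normr0 //; lia.
Qed.

Lemma refactors_bounded U L L' U' : refactors U L L' U' ->
  bounded_coefs U -> bounded_coefs L -> bounded_coefs L' /\ bounded_coefs U'.
Proof.
move=> r [_ bU] [bL _]; have [[posU posL] [[nL' _] [nU' _]] _] := r.
have [] := exchange_bounded (refactors_exchange r) posU.2 posL.2 bU bL.
by split; [apply/bounded_coefs_lower|apply/bounded_coefs_upper].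
Qed.

(** * The diamond property of adjacent refactorization *)

Local Notation step := (@adjacent_refactorization R).
Local Notation steps := (@adjacent_refactorizations R).

Lemma step_head U L L' U' s :
  refactors U L L' U' -> step [:: U, L & s] [:: L', U' & s].
Proof. by move=> [pos pos' e]; exists [::], s, U, L, L', U'. Qed.

Lemma step_cons A s t : step s t -> step (A :: s) (A :: t).
Proof.
move=> [s1 [s2 [U [L [L' [U' [-> -> pos pos' e]]]]]]].
by exists (A :: s1), s2, U, L, L', U'.
Qed.

Variant step_cons_spec A s t : Prop :=
| StepHead L L' U' s2 of
    s = L :: s2 & t = [:: L', U' & s2] & refactors A L L' U'
| StepTail t' of t = A :: t' & step s t'.

Lemma step_consP A s t : step (A :: s) t -> step_cons_spec A s t.
Proof.
move=> [[|B s1] [s2 [U [L [L' [U' [/= [-> ->] -> pos pos' e]]]]]]].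
  exact: StepHead.
apply: StepTail => //; by exists s1, s2, U, L, L', U'.
Qed.

(** After a pair $U$, $L$ at the head, a step on the tail cannot use $L$, which
    is not upper: this is why two distinct steps never overlap. *)
Lemma step_head_tail U L L' U' s t :
  refactors U L L' U' -> step (L :: s) t ->
  exists2 t', t = L :: t' & step s t'.
Proof.
move=> [[_ [nL _]] _ _] /step_consP[L2 L3 U3 s2 _ _ [[[nL2 _] _] _ _]|t' -> st].
  by case: (lower_upper_absurd nL nL2).
by exists t'.
Qed.

(** Strip the common head of the two steps until one of them acts at the head.
    If both do, the refactored pairs coincide; if only one does, the other acts
    beyond its pair, and the two steps commute. *)
Lemma step_diamond s t1 t2 : step s t1 -> step s t2 ->
  t1 = t2 \/ exists2 t, step t1 t & step t2 t.
Proof.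
elim: s t1 t2 => [|A s IHs] t1 t2.
  by move=> [[|? ?] [? [? [? [? [? []]]]]]].
move=> /step_consP[L L1 U1 s2 -> -> r1|t1' -> st1].
  move=> /step_consP[_ L2 U2 _ [<- <-] -> r2|t2' ->].
    by left; have [-> ->] := refactors_unique r1 r2.
  move=> /(step_head_tail r1)[t -> st]; right.
  exists [:: L1, U1 & t]; first by do 2!apply: step_cons.
  exact: step_head.
move=> /step_consP[L L2 U2 s2 es -> r2|t2' -> st2].
  move: st1; rewrite es => /(step_head_tail r2)[t -> st]; right.
  exists [:: L2, U2 & t]; first exact: step_head.
  by do 2!apply: step_cons.
have [->|[t st1' st2']] := IHs _ _ st1 st2; [by left | right].
by exists (A :: t); apply: step_cons.
Qed.

(** * Invariants and termination *)

Definition is_upper A := `[<normalized_upper A>].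

Lemma is_upper_upper U : positive_upper U -> is_upper U.
Proof. by case=> nU _; apply/asboolP. Qed.

Lemma is_upper_lower L : positive_lower L -> is_upper L = false.
Proof. by case=> nL _; apply/asboolP => /(lower_upper_absurd nL). Qed.

(** The number of pairs (true, false) in this order, not only adjacent ones. *)
Fixpoint inversions (b : bitseq) : nat :=
  if b is x :: b' then (x * count negb b' + inversions b')%N else 0.

Lemma step_inversions s t : step s t ->
  (inversions (map is_upper t) < inversions (map is_upper s))%N.
Proof.
move=> [s1 [s2 [U [L [L' [U' [-> -> [pU pL] [pL' pU'] _]]]]]]].
rewrite !map_cat /= (is_upper_upper pU) (is_upper_upper pU') (is_upper_lower pL)
  (is_upper_lower pL') //.
elim: (map _ s1) => [|x b IHb] /=; first by lia.
by rewrite !count_cat /=; lia.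
Qed.

Lemma step_size s t : step s t -> size t = size s.
Proof.
by move=> [s1 [s2 [U [L [L' [U' [-> -> _ _ _]]]]]]]; rewrite !size_cat.
Qed.

Lemma step_count_upper s t :
  step s t -> count is_upper t = count is_upper s.
Proof.
move=> [s1 [s2 [U [L [L' [U' [-> -> [pU pL] [pL' pU'] _]]]]]]].
by rewrite !count_cat /= (is_upper_upper pU) (is_upper_upper pU')
  (is_upper_lower pL) (is_upper_lower pL').
Qed.

Lemma step_prodsemimx s t : step s t -> prodsemimx t = prodsemimx s.
Proof.
move=> [s1 [s2 [U [L [L' [U' [-> -> pos pos' e]]]]]]].
elim: s1 => [|A s1 IHs] /=; last by rewrite IHs.
by rewrite (@refactors_mul U L L' U').
Qed.

Definition positive_list s :=
  all (fun A => `[<positive_lower A \/ positive_upper A>]) s.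

Lemma step_positive s t : step s t -> positive_list s -> positive_list t.
Proof.
move=> [s1 [s2 [U [L [L' [U' [-> -> _ [pL' pU'] _]]]]]]].
rewrite /positive_list !all_cat /= => /and4P[-> _ _ ->].
by rewrite /= andbT; apply/andP; split; apply/asboolP; [left|right].
Qed.

Definition bounded_list s := all (fun A => `[<bounded_coefs A>]) s.

Lemma step_bounded s t : step s t -> bounded_list s -> bounded_list t.
Proof.
move=> [s1 [s2 [U [L [L' [U' [-> -> pos pos' e]]]]]]].
rewrite /bounded_list !all_cat /= => /and4P[-> /asboolP bU /asboolP bL ->].
have [bL' bU'] := refactors_bounded (And3 pos pos' e) bU bL.
by rewrite /= andbT; apply/andP; split; apply/asboolP.
Qed.

(** * Lower--upper lists are the normal forms *)

Definition lower_list s := all (fun A => `[<positive_lower A>]) s.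
Definition upper_list s := all (fun A => `[<positive_upper A>]) s.

Lemma step_lower_upper_ordered s t : step s t -> ~ lower_upper_ordered s.
Proof.
move=> [s1 [s2 [U [L [L' [U' [-> _ [[nU _] [nL _]] _ _]]]]]]] ord.
by apply: (ord s1 [::] s2 U L).
Qed.

(** Progress: if the tail is already lower--upper, the head either extends it
    or is an upper factor directly followed by a lower one, and such a pair can
    always be refactored. *)
Lemma positive_list_cases s : positive_list s ->
  (exists t, step s t) \/
  exists s1 s2, [/\ s = s1 ++ s2, lower_list s1 & upper_list s2].
Proof.
elim: s => [_|A s IHs]; first by right; exists [::], [::].
move=> /= /andP[/asboolP posA /IHs[[t st]|[s1 [s2 [-> low1 up2]]]]].
  by left; exists (A :: t); apply: step_cons.
case: posA => [posA|posA].
  by right; exists (A :: s1), s2; split=> //=; apply/andP; split=> //;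
    apply/asboolP.
case: s1 low1 => [_|L s1 /= /andP[/asboolP posL _]].
  by right; exists [::], (A :: s2); split=> //=; apply/andP; split=> //;
    apply/asboolP.
have [L' [U' r]] := refactors_exists posA posL.
by left; exists [:: L', U' & s1 ++ s2]; apply: step_head.
Qed.

Lemma lower_cat_upper_ordered s1 s2 :
  lower_list s1 -> upper_list s2 -> lower_upper_ordered (s1 ++ s2).
Proof.
elim: s1 => [_ up2|C s1 IHs /= /andP[/asboolP[nC _] low1] up2]
  [|D t1] t2 t3 A B /=.
- move=> e [_ nB]; move: up2; rewrite e /upper_list /= all_cat /=.
  move=> /and4P[_ _ /asboolP[nB' _] _]; exact: lower_upper_absurd nB'.
- move=> e [_ nB]; move: up2; rewrite e /upper_list /= all_cat /= all_cat /=.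
  move=> /and3P[_ _ /and4P[_ _ /asboolP[nB' _] _]].
  exact: lower_upper_absurd nB'.
- by move=> [<- _] [nC' _]; apply: lower_upper_absurd nC'.
- by move=> [_ /IHs]; apply.
Qed.

Lemma lower_upper_orderedP s : positive_list s ->
  lower_upper_ordered s <-> normal_form step s.
Proof.
move=> pos; split=> [ord t st|nf]; first exact: step_lower_upper_ordered st ord.
have [[t /nf//]|[s1 [s2 [-> low up]]]] := positive_list_cases pos.
exact: lower_cat_upper_ordered.
Qed.

Lemma count_upper_lower_list s : lower_list s -> count is_upper s = 0%N.
Proof.
by elim: s => //= A s IHs /andP[/asboolP posA /IHs->]; rewrite is_upper_lower.
Qed.

Lemma count_upper_upper_list s : upper_list s -> count is_upper s = size s.
Proof.
by elim: s => //= A s IHs /andP[/asboolP posA /IHs->]; rewrite is_upper_upper.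
Qed.

Lemma positive_factorsP p q (L : p.-tuple (semimx R))
    (U : q.-tuple (semimx R)) :
  positive_factors L U <-> lower_list L /\ upper_list U.
Proof.
split=> [[posL posU]|[/all_tnthP posL /all_tnthP posU]].
  by split; apply/all_tnthP => i; apply/asboolP; auto.
by split=> i; apply/asboolP; [apply: posL|apply: posU].
Qed.

Lemma bounded_factorsP p q (L : p.-tuple (semimx R))
    (U : q.-tuple (semimx R)) :
  positive_factors L U -> bounded_factors L U <-> bounded_list (factors L U).
Proof.
move=> [posL posU]; rewrite /bounded_list all_cat all_rev.
split=> [[bL bU]|/andP[/all_tnthP bL /all_tnthP bU]].
  apply/andP; split; apply/all_tnthP => i; apply/asboolP.
    by apply/bounded_coefs_lower; auto; case: (posL i).
  by apply/bounded_coefs_upper; auto; case: (posU i).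
split=> i; first by have /asboolP[] := bL i.
by have /asboolP[] := bU i.
Qed.

Lemma lower_upper_normal_form p q s :
    positive_list s -> normal_form step s ->
    size s = (p + q)%N -> count is_upper s = q ->
  exists (L : p.-tuple (semimx R)) (U : q.-tuple (semimx R)),
    s = factors L U /\ positive_factors L U.
Proof.
move=> pos nf sz.
have [[t /nf//]|[s1 [s2 [es low up]]]] := positive_list_cases pos.
rewrite es count_cat count_upper_lower_list // count_upper_upper_list // add0n.
move=> sz2; have sz1 : size s1 == p by move: sz; rewrite es size_cat; lia.
have szr : size (rev s2) == q by rewrite size_rev sz2.
exists (Tuple sz1), (Tuple szr); split; first by rewrite /factors /= revK.
by apply/positive_factorsP; split=> //; rewrite /upper_list all_rev.
Qed.

Lemma all_cyclic_list (Q : pred (semimx R)) s a :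
  all Q (cyclic_list s a) = all Q s.
Proof. by rewrite all_cat andbC -all_cat cat_take_drop. Qed.

Lemma count_cyclic_list (Q : pred (semimx R)) s a :
  count Q (cyclic_list s a) = count Q s.
Proof. by rewrite count_cat addnC -count_cat cat_take_drop. Qed.

End BidiagonalRefactorization.

Theorem theorem2p3 (R : realType) (p q : nat) (p_ge1 : (1 <= p)%N)
    (q_ge1 : (1 <= q)%N)
    (L : p.-tuple (semimx R)) (U : q.-tuple (semimx R))
    (posLU : positive_factors L U)
    (a : nat) (a_range : (1 <= a <= p + q)%N) :
  exists (L' : p.-tuple (semimx R)) (U' : q.-tuple (semimx R)),
    (positive_factors L' U' /\
     cyclic_product (factors L U) a = prodsemimx (factors L' U')) /\
    (adjacent_refactorizations (cyclic_list (factors L U) a) (factors L' U') /\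
     lower_upper_ordered (factors L' U')) /\
    (~ exists f : nat -> seq (semimx R),
         f 0%N = cyclic_list (factors L U) a /\
         forall n, adjacent_refactorization (f n) (f n.+1)) /\
    (forall s, adjacent_refactorizations (cyclic_list (factors L U) a) s ->
       ~ lower_upper_ordered s -> exists s', adjacent_refactorization s s') /\
    (forall s, adjacent_refactorizations (cyclic_list (factors L U) a) s ->
       lower_upper_ordered s -> s = factors L' U') /\
    (bounded_factors L U -> bounded_factors L' U').
Proof.
set s0 := cyclic_list _ _.
have [lowL upU] := (positive_factorsP L U).1 posLU.
have pos0 : positive_list s0.
  rewrite /positive_list all_cyclic_list all_cat all_rev; apply/andP; split.
    by apply: sub_all lowL => A /asboolP ?; apply/asboolP; left.
  by apply: sub_all upU => A /asboolP ?; apply/asboolP; right.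
have pos s : adjacent_refactorizations s0 s -> positive_list s.
  by move=> s0s; apply: (clos_refl_trans_preserves (@step_positive R) s0s).
have [t s0t nt] := normal_form_exists (@step_inversions R) s0.
have szt : size t = (p + q)%N.
  apply: (clos_refl_trans_preserves (Q := fun s => size s = (p + q)%N) _ s0t).
    by move=> x y /step_size->.
  by rewrite size_rot size_cat size_rev !size_tuple.
have cnt : count is_upper t = q.
  apply: (clos_refl_trans_preserves (Q := fun s => count is_upper s = q) _ s0t).
    by move=> x y /step_count_upper->.
  rewrite count_cyclic_list count_cat count_rev count_upper_lower_list //.
  by rewrite count_upper_upper_list // size_tuple.
have [L' [U' [et posLU']]] := lower_upper_normal_form (pos t s0t) nt szt cnt.
exists L', U'; rewrite -et.
split; [split=> //|split; [split=> //|split; [|split; [|split]]]].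
- apply: (clos_refl_trans_preserves
    (Q := fun s => prodsemimx s0 = prodsemimx s) _ s0t) => // x y.
  by move=> /step_prodsemimx->.
- by apply/lower_upper_orderedP; auto.
- exact: no_infinite_chain (@step_inversions R) _.
- move=> s /pos poss nord.
  have [//|[s1 [s2 [es low up]]]] := positive_list_cases poss.
  by case: nord; rewrite es; apply: lower_cat_upper_ordered.
- move=> s s0s /lower_upper_orderedP -/(_ (pos s s0s)) ns.
  exact: (normal_form_unique (@step_diamond R) s0s ns s0t nt).
- move=> /(bounded_factorsP posLU) b; apply/(bounded_factorsP posLU').
  rewrite -et; apply: (clos_refl_trans_preserves (@step_bounded R) s0t).
  by rewrite /bounded_list all_cyclic_list.
Qed.
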